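(* Let $p$ and $q$ be two non-constant holomorphic polynomials in one complex variable (with complex coefficients), and let $$S=\{(z,w)\in\mathbb{C}^2: q(w)=\overline{p(z)}\}.$$ Then every compact subset $K$ of $S$ is polynomially convex and satisfies $\mathscr{P}(K)=\mathcal{C}(K)$.
   Context: For a compact set $K\subset\mathbb{C}^n$, the polynomially convex hull is $\widehat{K}=\{z\in\mathbb{C}^n: |f(z)|\le \sup_K|f| \text{ for all } f\in\mathbb{C}[z_1,\dots,z_n]\}$, and $K$ is called polynomially convex if $\widehat{K}=K$. $\mathcal{C}(K)$ denotes the algebra of all continuous complex-valued functions on $K$ (with the uniform norm), and $\mathscr{P}(K)$ denotes the closed subalgebra of $\mathcal{C}(K)$ generated by the (restrictions to $K$ of) holomorphic polynomials in $z_1,\dots,z_n$. Here $n=2$, with coordinates $(z,w)$. *)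

(* Defs.v *)
From HB Require Import structures.
From mathcomp Require Import all_boot all_order all_algebra.
From mathcomp Require Import all_classical all_reals all_analysis.
From mathcomp Require Import complex.
(* Not imported: the notations of mpoly clash with those of the analysis
   library. *)
From mathcomp Require mpoly.

Set Implicit Arguments.
Unset Strict Implicit.
Unset Printing Implicit Defensive.

Import Order.TTheory GRing.Theory Num.Theory numFieldNormedType.Exports.

Local Open Scope classical_set_scope.
Local Open Scope ring_scope.

(* The library topologizes R[i]^o, for the generic numFieldType R[i], but not
   R[i] itself; the vector space C^n = 'rV[R[i]]_n then gets its product
   topology from the matrix instances. *)
#[non_forgetful_inheritance]
HB.instance Definition _ (R : realType) :=
  PseudoPointedMetric.copy R[i] R[i]^o.
#[non_forgetful_inheritance]
HB.instance Definition _ (R : realType) := NormedModule.copy R[i] R[i]^o.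

Section PolynomialConvexity.
Variables (R : realType) (n : nat).
Local Notation C := R[i].
Implicit Types (K : set 'rV[C]_n).

(* The norm of R[i] takes its (real) values in R[i]; this is the same modulus
   valued in R, where suprema are available. *)
Definition modulus (x : C) : R := complex.Re `|x|.

Definition poly_fun (f : mpoly.mpoly n C) (z : 'rV[C]_n) : C :=
  mpoly.meval (z 0) f.

Definition poly_hull K : set 'rV[C]_n :=
  [set z | forall f : mpoly.mpoly n C,
     modulus (poly_fun f z) <= sup [set modulus (poly_fun f x) | x in K]].

Definition polynomially_convex K : Prop := poly_hull K = K.

(* Below, functions are defined on the subtype of K,
   which carries the topology induced by that of C^n. *)
Definition continuous_functions K : set (K -> C) :=
  [set f : K -> C | continuous f].

Definition poly_restrictions K : set (K -> C) :=
  [set f | exists g : mpoly.mpoly n C, f = poly_fun g \o set_val].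

(* Closed with respect to the uniform norm; as uniform limits of continuous
   functions are continuous, being closed among all functions on K amounts to
   being closed in the algebra of continuous functions. *)
Definition closed_subalgebra K (A : set (K -> C)) : Prop :=
  [/\ A `<=` @continuous_functions K,
      A 1,
      forall (c : C) (f g : K -> C), A f -> A g -> A (c *: f + g),
      forall f g : K -> C, A f -> A g -> A (f * g)
    & closed (A : set {uniform K -> C})].

Definition uniform_poly_algebra K : set (K -> C) :=
  smallest (@closed_subalgebra K) (@poly_restrictions K).

End PolynomialConvexity.

Arguments continuous_functions {R n} K.
Arguments poly_restrictions {R n} K.
Arguments uniform_poly_algebra {R n} K.

(* The coordinates (z, w) of a vector v of C^2 are v 0 0 and v 0 1. *)
Definition conj_curve (R : realType) (p q : {poly R[i]}) : set 'rV[R[i]]_2 :=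
  [set v | q.[v 0 1] = (p.[v 0 0])^*%C].

(* Main.v *)
(* On K the polynomials p(z) and q(w) are conjugate to each other, so
   |p(z) - c|^2 is a polynomial on K for every c.  Each fibre of p(z) in K is
   finite, hence any continuous f is interpolated on it by a polynomial, which
   approximates f on a neighbourhood {|p(z) - c|^2 < b} of the fibre.  Real
   polynomials in |p(z) - c|^2 that are close to 1 near the fibre and close to
   0 away from it glue these local approximations together.  Density gives
   polynomial convexity: for z outside K, the continuous functions
   g_i = conj (y_i - z_i) / |y - z|^2 satisfy sum_i (y_i - z_i) g_i = 1 on K;
   replacing g_i by approximating polynomials in 1 - sum_i (y_i - z_i) g_i
   yields a polynomial that is small on K and equals 1 at z. *)
Require Import Defs.
From mathcomp Require Import all_boot all_order all_algebra.
From mathcomp Require Import all_classical all_reals all_analysis.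
From mathcomp Require Import complex.
(* The notations of mpoly clash with those of the analysis library. *)
From mathcomp Require Import (canonicals) mpoly.
From mathcomp Require Import ring lra.

Import Order.TTheory GRing.Theory Num.Theory numFieldNormedType.Exports.

Local Open Scope classical_set_scope.
Local Open Scope ring_scope.

Set Implicit Arguments.
Unset Strict Implicit.
Unset Printing Implicit Defensive.

(** * The modulus *)

Section Modulus.
Variable R : realType.
Implicit Types z w : R[i].

Lemma normr_modulus z : `|z| = (modulus z)%:C%C.
Proof. by []. Qed.

Lemma modulus_ge0 z : 0 <= modulus z.
Proof. by have := normr_ge0 z; rewrite normr_modulus -[0]/(0%:C%C) lecR. Qed.

Lemma modulus_eq0 z : modulus z = 0 -> z = 0.
Proof. by move=> z0; apply/normr0_eq0; rewrite normr_modulus z0. Qed.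

Lemma modulusM z w : modulus (z * w) = modulus z * modulus w.
Proof. by apply: complexI; rewrite rmorphM /= -!normr_modulus normrM. Qed.

Lemma modulusD z w : modulus (z + w) <= modulus z + modulus w.
Proof. by rewrite -lecR rmorphD /= -!normr_modulus ler_normD. Qed.

Lemma modulus_distC z w : modulus (z - w) = modulus (w - z).
Proof. by rewrite /modulus distrC. Qed.

Lemma modulus_real (r : R) : modulus r%:C%C = `|r|.
Proof.
by apply: complexI; rewrite -normr_modulus normc_def /= expr0n addr0 sqrtr_sqr.
Qed.

Lemma modulus0 : modulus 0 = 0 :> R.
Proof. by have := modulus_real 0; rewrite normr0. Qed.

Lemma modulus1 : modulus 1 = 1 :> R.
Proof. by have := modulus_real 1; rewrite normr1. Qed.

Lemma modulus_conj z : modulus z^*%C = modulus z.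
Proof. by rewrite /modulus normcJ. Qed.

Lemma mulr_conjc z : z * z^*%C = (modulus z ^+ 2)%:C%C.
Proof. by rewrite rmorphXn /= -normr_modulus sqr_normc. Qed.

Lemma modulus_dist z w : `|modulus z - modulus w| <= modulus (z - w).
Proof.
rewrite ler_norml; have := modulusD (z - w) w; have := modulusD (w - z) z.
by rewrite !subrK (modulus_distC w); lra.
Qed.

(** An element of [R[i]] is positive only if its imaginary part vanishes, so real radii suffice to
    test convergence. *)
Lemma cvg_modulusP (T : Type) (F : set_system T) (FF : Filter F)
    (f : T -> R[i]) z :
  (f @ F --> z) <->
  forall e : R, 0 < e -> \forall x \near F, modulus (z - f x) < e.
Proof.
split=> [/cvgrPdist_lt fz e e0|fz].
  have := fz e%:C%C; rewrite ltcR => /(_ e0); apply: filterS => x.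
  by rewrite normr_modulus ltcR.
apply/cvgrPdist_lt => -[a b]; rewrite ltcE /= => /andP[/eqP-> a0].
apply: filterS (fz a a0) => x.
by rewrite ltcE /= eqxx.
Qed.

Lemma continuous_modulus (T : topologicalType) (f : T -> R[i]) :
  continuous f -> continuous (fun x => modulus (f x)).
Proof.
move=> cf x; apply/cvgrPdist_lt => e e0.
have /cvg_modulusP/(_ e e0) := cf x; apply: filterS => y.
by apply: le_lt_trans; exact: modulus_dist.
Qed.

Lemma continuous_conjc (T : topologicalType) (f : T -> R[i]) :
  continuous f -> continuous (fun x => (f x)^*%C).
Proof.
move=> cf x; apply/cvg_modulusP => e e0.
have /cvg_modulusP/(_ e e0) := cf x; apply: filterS => y.
by rewrite -rmorphB modulus_conj.
Qed.

End Modulus.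

(** * Gluing local approximations *)

Section StepPolynomial.
Variable R : realType.

Lemma bernoulli_inequality (x : R) (m : nat) :
  -1 <= x -> 1 + m%:R * x <= (1 + x) ^+ m.
Proof.
move=> x1; elim: m => [|m IH]; first by rewrite mul0r addr0 expr0.
rewrite exprS -natr1; apply: le_trans (ler_wpM2l _ IH); last by lra.
by have := ler0n R m; nra.
Qed.

(* The Brosowski-Deutsch polynomial (1 - y^n)^m. *)
Lemma step_polynomial (b eta : R) : 0 < b <= 1 -> 0 < eta ->
  exists P : {poly R}, forall y, 0 <= y <= 1 ->
    [/\ 0 <= P.[y] <= 1, y <= b / 2 -> 1 - eta <= P.[y]
      & b <= y -> P.[y] <= eta].
Proof.
move=> /andP[b0 b1] eta0; pose c := eta^-1.
have c0 : 0 < c by rewrite invr_gt0.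
have ceta : c * eta = 1 by rewrite mulVf ?gt_eqF.
(* The exponents are such that, for s = y^n, m s is below (c + 1) c / 2^n / c < [eta] when y <= b /
   2 and exceeds c = 1 / [eta] when y >= b. *)
pose n := Num.bound ((c + 1) * c).
have n_gt : (c + 1) * c < 2 ^+ n by apply: upper_nthrootP.
pose t := b ^+ n; have t0 : 0 < t by rewrite exprn_gt0.
have t1 : t <= 1 by rewrite exprn_ile1 // ltW.
pose m := (Num.truncn (c / t)).+1.
have m_gt : c < m%:R * t by rewrite -ltr_pdivrMr // truncnS_gt.
have m_le : m%:R * t <= c + 1.
  have : (m%:R : R) <= c / t + 1.
    by rewrite -natr1 lerD2r truncn_le divr_ge0 // ltW.
  move=> /(ler_wpM2r (ltW t0)) /le_trans; apply.
  by rewrite mulrDl divfK ?gt_eqF // lerD2l mul1r.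
exists ((1 - 'X^n) ^+ m) => y /andP[y0 y1]; rewrite !hornerE.
have s0 : 0 <= y ^+ n by rewrite exprn_ge0.
have s1 : y ^+ n <= 1 by rewrite exprn_ile1.
set s := y ^+ n in s0 s1 *.
have P0 : 0 <= (1 - s) ^+ m by rewrite exprn_ge0 // subr_ge0.
split.
- by rewrite P0 exprn_ile1 //; lra.
- have := @bernoulli_inequality (- s) m; have -> : -1 <= - s by lra.
  move=> /(_ isT) Ps yb; apply: le_trans Ps; rewrite mulrN lerD2l lerN2.
  have sle : s * 2 ^+ n <= t.
    by rewrite -exprMn lerXn2r ?nnegrE ?mulr_ge0 ?(ltW b0) // -ler_pdivlMr.
  have m0 : (0 : R) <= m%:R by rewrite ler0n.

  have p0 : (0 : R) < 2 ^+ n by rewrite exprn_gt0.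
  rewrite -(ler_pM2r p0) -mulrA.
  apply: le_trans (ler_wpM2l m0 sle) _; apply: le_trans m_le _.
  by rewrite mulrC -ler_pdivrMr // ltW.
- move=> yb; have ts : t <= s by rewrite lerXn2r // nnegrE // ltW.
  (* Multiplying Bernoulli's bound by (1 - s)^m gives (1 - s)^m (1 + m s) <= (1 - s^2)^m <= 1. *)
  have := @bernoulli_inequality s m; have -> : -1 <= s by lra.
  move=> /(_ isT) /(ler_wpM2l P0); rewrite -exprMn => sm.
  have sm1 : ((1 - s) * (1 + s)) ^+ m <= 1.
    by rewrite exprn_ile1 //; nra.
  have cs : c <= 1 + m%:R * s.
    have := ler_wpM2l (ler0n R m) ts; lra.
  rewrite -(ler_pM2r c0) [eta * c]mulrC ceta.
  by apply: le_trans sm1; apply: le_trans sm; rewrite ler_wpM2l.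
Qed.

End StepPolynomial.

(** If [P] failed on the whole space, the complements of the sets satisfying [P] would form a proper
    filter; at a cluster point this contradicts the local hypothesis. *)
Lemma compact_induction (T : topologicalType) (P : set T -> Prop) :
  compact [set: T] -> P set0 -> (forall U V, U `<=` V -> P V -> P U) ->
  (forall U V, P U -> P V -> P (U `|` V)) ->
  (forall x : T, exists2 U, nbhs x U & P U) -> P setT.
Proof.
move=> Tco P0 PS PU Ploc; apply: contrapT => PT.
pose F := [set V : set T | P (~` V)].
have FF : ProperFilter F.
  split; first by rewrite /F /= setC0.
  split; first by rewrite /F /= setCT.
    by move=> U V FU FV; rewrite /F /= setCI; apply: PU.
  by move=> U V UV; apply: PS; exact: subsetC.
have [x [_ Fx]] := Tco F FF filterT.
have [U xU PUx] := Ploc x.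
by have [] := Fx (~` U) U _ xU; [rewrite /F /= setCK | move=> y []].
Qed.

Lemma compact_has_bound (R : realType) (T : topologicalType) (h : T -> R) :
  compact [set: T] -> continuous h ->
  exists2 M : R, 0 <= M & forall x, h x <= M.
Proof.
move=> Tco hc; have [T0|/set0P T0] := eqVneq [set: T] set0.
  by exists 0 => // x; have : [set: T] x by []; rewrite T0.
have [c _ cmax] := compact_EVT_max T0 Tco (continuous_subspaceT hc).
exists `|h c| => // x; apply: le_trans (ler_norm _).
by apply: cmax; rewrite inE.
Qed.

(** * Subalgebras of complex-valued functions *)

Section Subalgebra.
Variable R : realType.
Local Notation C := R[i].

(** Only the algebraic clauses of [closed_subalgebra] are kept, so that the polynomials themselves
    qualify before any closure is taken. *)
Definition subalgebra (T : Type) (A : set (T -> C)) : Prop :=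
  [/\ A 1, forall (c : C) f g, A f -> A g -> A (c *: f + g)
    & forall f g, A f -> A g -> A (f * g)].

Section Closure.
Variables (T : Type) (A : set (T -> C)).
Hypothesis Aalg : subalgebra A.

Lemma subalgebra0 : A 0.
Proof.
by case: Aalg => A1 AD _; rewrite -(addNr 1) -scaleN1r; apply: AD.
Qed.

Lemma subalgebra_cst (c : C) : A (fun=> c).
Proof.
case: Aalg => A1 AD _; have -> : (fun=> c) = c *: (1 : T -> C) + 0.
  by apply/funext => x; rewrite addr0 /= fctE /= /GRing.scale /= mulr1.
by apply: AD => //; exact: subalgebra0.
Qed.

Lemma subalgebraZ (c : C) f : A f -> A (fun x => c * f x).
Proof. by case: Aalg => _ _ AM Af; apply: AM => //; exact: subalgebra_cst. Qed.

Lemma subalgebraD f g : A f -> A g -> A (fun x => f x + g x).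
Proof.
case: Aalg => _ AD _ Af Ag.
by have := AD 1 f g Af Ag; rewrite scale1r.
Qed.

Lemma subalgebraM f g : A f -> A g -> A (fun x => f x * g x).
Proof. by case: Aalg => _ _; apply. Qed.

Lemma subalgebraB f g : A f -> A g -> A (fun x => f x - g x).
Proof.
move=> Af Ag; apply: subalgebraD => //.
have := subalgebraZ (-1) Ag; congr A; apply/funext => x; exact: mulN1r.
Qed.

Lemma subalgebra_horner f (P : {poly C}) : A f -> A (fun x => P.[f x]).
Proof.
move=> Af; elim/poly_ind: P => [|P c IH].
  have -> : (fun x => 0.[f x]) = (fun=> 0) :> (T -> C).
    by apply/funext => x; rewrite horner0.
  exact: subalgebra_cst.
have -> : (fun x => (P * 'X + c%:P).[f x]) = (fun x => P.[f x] * f x + c).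
  by apply/funext => x; rewrite hornerMXaddC.
by apply: subalgebraD; [exact: subalgebraM|exact: subalgebra_cst].
Qed.

Lemma subalgebra_real_horner (u : T -> R) (P : {poly R}) :
  A (fun x => (u x)%:C%C) -> A (fun x => P.[u x]%:C%C).
Proof.
move=> Au; have := subalgebra_horner (map_poly (real_complex R) P) Au.
by congr A; apply/funext => x; rewrite horner_map.
Qed.

End Closure.

(** Newton interpolation: the value at each new point is corrected by a multiple of a function that
    vanishes at the points already treated. *)
Lemma subalgebra_interpolation (T : eqType) (A : set (T -> C)) (s : seq T)
    (f : T -> C) :
  subalgebra A -> (forall x y, x != y -> exists2 g, A g & g x != g y) ->
  exists2 g, A g & forall y, y \in s -> g y = f y.
Proof.
move=> Aalg Asep.
have vanish a (t : seq T) : a \notin t ->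
    exists2 e, A e & e a != 0 /\ forall y, y \in t -> e y = 0.
  elim: t => [_|b t IH].
    by exists (fun=> 1); [exact: subalgebra_cst|rewrite oner_eq0].
  rewrite in_cons negb_or => /andP[ab /IH[e Ae [ea et]]].
  have [g Ag gab] := Asep _ _ ab.
  exists (fun x => (g x - g b) * e x).
    apply: subalgebraM => //; apply: subalgebraB => //.
    exact: subalgebra_cst.
  split=> [|y]; first by rewrite mulf_neq0 // subr_eq0.
  rewrite in_cons => /orP[/eqP ->|/et ->]; first by rewrite subrr mul0r.
  by rewrite mulr0.
elim: s => [|a s [g Ag gs]].
  by exists (fun=> 0) => //; exact: subalgebra_cst.
have [ins|nins] := boolP (a \in s).
  by exists g => // y; rewrite in_cons => /orP[/eqP ->|]; exact: gs.
have [e Ae [ea es]] := vanish _ _ nins.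
exists (fun x => g x + (f a - g a) / e a * e x).
  by apply: subalgebraD => //; exact: subalgebraZ.
move=> y; rewrite in_cons => /orP[/eqP ->|ys]; first by rewrite divfK // subrKC.
by rewrite (es y ys) mulr0 addr0 gs.
Qed.

(** * Uniform density on a compact space *)

Section Density.
Variables (T : topologicalType) (A : set (T -> C)).
Hypotheses (Tco : compact [set: T]) (Aalg : subalgebra A)
  (Acont : forall f, A f -> continuous f).

(** A step polynomial in [u] serves as the weight of a convex combination: it selects [g1] where [u]
    is small and [g2] where [u] is large, and in the transition zone inside [W] both are
    accurate. *)
Lemma glue_approximations (f g1 g2 : T -> C) (u : T -> R) (W : set T)
    (b e e' : R) :
  continuous f -> A (fun x => (u x)%:C%C) -> (forall x, 0 <= u x <= 1) ->
  0 < b <= 1 -> e < e' -> A g1 -> A g2 ->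
  (forall x, u x < b -> modulus (f x - g1 x) <= e) ->
  (forall x, W x -> modulus (f x - g2 x) <= e) ->
  exists2 g, A g &
    forall x, W x \/ u x <= b / 2 -> modulus (f x - g x) <= e'.
Proof.
move=> fc Au u01 b01 ee Ag1 Ag2 fg1 fg2.
have bnd g : A g -> exists2 M : R, 0 <= M & forall x, modulus (f x - g x) <= M.
  move=> Ag; apply: compact_has_bound => //; apply: continuous_modulus => x.
  by apply: cvgB; [exact: fc|exact: Acont].
have [M1 M10 fM1] := bnd _ Ag1; have [M2 M20 fM2] := bnd _ Ag2.
(* An inaccurate function has weight at most [eta], so it contributes at most [e' - e]; the summand
   1 keeps the denominator positive. *)
pose eta := (e' - e) / (M1 + M2 + 1).
have M0 : 0 < M1 + M2 + 1 by lra.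
have eta0 : 0 < eta by rewrite divr_gt0 // subr_gt0.
have etaM : eta * (M1 + M2 + 1) = e' - e by rewrite divfK // gt_eqF.
have [P PP] := step_polynomial b01 eta0.
pose v x := P.[u x].
exists (fun x => (v x)%:C%C * g1 x + (1 - (v x)%:C%C) * g2 x).
  have Av := subalgebra_real_horner Aalg P Au.
  apply: subalgebraD => //; apply: subalgebraM => //.
  by apply: subalgebraB => //; exact: subalgebra_cst.
move=> x Wux; have [/andP[v0 v1] vlow vhigh] := PP _ (u01 x).
rewrite -/(v x) in v0 v1 vlow vhigh.
have -> : f x - ((v x)%:C%C * g1 x + (1 - (v x)%:C%C) * g2 x) =
  (v x)%:C%C * (f x - g1 x) + (1 - v x)%:C%C * (f x - g2 x).
  by rewrite rmorphB rmorph1; ring.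
apply: le_trans (modulusD _ _) _; rewrite !modulusM !modulus_real.
rewrite ger0_norm // ger0_norm ?subr_ge0 //.
have m1 := modulus_ge0 (f x - g1 x); have m2 := modulus_ge0 (f x - g2 x).
have := fM1 x; have := fM2 x; move: (fg1 x) (fg2 x) m1 m2.
set m1 := modulus _; set m2 := modulus _ => mb mW m10 m20 mM2 mM1.
have [b0 b1] := andP b01.
case: Wux => [/mW mW'|ub].
  have [/mb mb'|/vhigh vl] := ltP (u x) b; nra.
have /mb mb' : u x < b by lra.
have := vlow ub; nra.
Qed.

(* The neighbourhoods that can be added to any set on which f is
   already approximated form an ideal of sets, so compactness reduces the
   approximation of f to a neighbourhood of a single fibre of phi. *)
Lemma dense_of_fiberwise (phi f : T -> C) :
  A phi -> A (fun x => (phi x)^*%C) -> continuous f ->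
  (forall x, exists2 g, A g & forall y, phi y = phi x -> g y = f y) ->
  forall e : R, 0 < e -> exists2 g, A g & forall x, modulus (f x - g x) <= e.
Proof.
move=> Aphi Aphic fc fib e e0.
(* The slack from [d] to [d'] is arbitrary, so finitely many gluings fit in a fixed budget. The
   bound [e / 2 <= d] lets a local approximation with error [e / 2] serve for every [d]. *)
pose absorbed (U : set T) := forall W g d d', A g -> e / 2 <= d -> d < d' ->
  (forall x, W x -> modulus (f x - g x) <= d) ->
  exists2 g', A g' & forall x, W x \/ U x -> modulus (f x - g' x) <= d'.
suff : absorbed setT.
  move=> /(_ set0 (fun=> 0) (e / 2) e) [|||//|g Ag gf].
  - exact: subalgebra_cst.
  - by [].
  - lra.
  - by exists g => // x; apply: gf; right.
apply: compact_induction => //.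
- move=> W g d d' Ag _ dd Wg; exists g => // x [/Wg|//] fg.
  exact: le_trans (ltW dd).
- move=> U V UV absV W g d d' Ag ed dd Wg.
  have [g' Ag' g'P] := absV W g d d' Ag ed dd Wg.
  by exists g' => // x [Wx|/UV Vx]; apply: g'P; [left|right].
- move=> U V absU absV W g d d' Ag ed dd Wg.
  have [g1 Ag1 g1P] := absU W g d ((d + d') / 2) Ag ed ltac:(lra) Wg.
  have [g2 Ag2 g2P] := absV (W `|` U) g1 ((d + d') / 2) d' Ag1
    ltac:(lra) ltac:(lra) g1P.
  by exists g2 => // x [Wx|[Ux|Vx]]; apply: g2P; rewrite /setU /=; tauto.
move=> x; pose h y := modulus (phi y - phi x) ^+ 2.
have hc : continuous h.
  have mc : continuous (fun y => modulus (phi y - phi x)).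
    apply: continuous_modulus => y.
    by apply: cvgB; [exact: Acont|exact: cvg_cst].
  by move=> y; apply: cvgM; exact: mc.
have [M M0 hM] := compact_has_bound Tco hc.
(* Dividing by [H] brings the values into [0, 1], as the step polynomial requires; adding 1 makes
   the divisor positive even if [M] is 0. *)
pose H := M + 1; have H0 : 0 < H by rewrite /H; lra.
pose u y := h y / H.
have h0 y : 0 <= h y by rewrite exprn_ge0 // modulus_ge0.
have u01 y : 0 <= u y <= 1.
  by rewrite divr_ge0 ?(ltW H0) //= ler_pdivrMr // mul1r /H; have := hM y; lra.
have uc : continuous u.
  by move=> y; apply: cvgM; [exact: hc|exact: cvg_cst].
have Au : A (fun y => (u y)%:C%C).
  (* The squared modulus is a product of two conjugate factors, both in [A]. *)
  have -> : (fun y => (u y)%:C%C) = (fun y => (H^-1)%:C%C *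
      ((phi y - phi x) * ((phi y)^*%C - (phi x)^*%C))) :> (T -> C).
    by apply/funext => y; rewrite -rmorphB mulr_conjc -rmorphM mulrC.
  apply: subalgebraZ => //; apply: subalgebraM => //.
    by apply: subalgebraB => //; exact: subalgebra_cst.
  by apply: subalgebraB => //; exact: subalgebra_cst.
have [g0 Ag0 g0f] := fib x.
(* The points where [g0] is off by at least [e / 2] form a compact set missing the fibre of [x],
   while [u] vanishes only on that fibre. The minimum of [u] on this set serves as [b], or 1 if the
   set is empty. *)
have [b b01 bP] : exists2 b, 0 < b <= 1 &
    forall y, u y < b -> modulus (f y - g0 y) <= e / 2.
  have mc : continuous (fun y => modulus (f y - g0 y)).
    apply: continuous_modulus => y.
    by apply: cvgB; [exact: fc|exact: Acont].
  pose Z := [set y | e / 2 <= modulus (f y - g0 y)].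
  have Zclosed : closed Z.
    by apply: (@preimage_closed _ _ _ [set r | e / 2 <= r]) => //;
      exact: closed_ge.
  have Zco : compact Z by apply: subclosed_compact Zclosed Tco _.
  have [Z0|/set0P Z0] := eqVneq Z set0.
    exists 1; first by rewrite ltr01 lexx.
    move=> y _; rewrite leNgt; apply/negP => /ltW Zy.
    by have : Z y by []; rewrite Z0.
  have [c] := compact_EVT_min Z0 Zco (continuous_subspaceT uc).
  rewrite inE => Zc cmin; exists (u c).
    have /andP[uc0 ->] := u01 c; rewrite andbT lt_neqAle uc0 andbT eq_sym.
    apply/negP => /eqP uc00; suff /g0f gc : phi c = phi x.
      by move: Zc; rewrite /Z /= gc subrr modulus0; lra.
    apply/eqP; rewrite -subr_eq0; apply/eqP/modulus_eq0/eqP.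
    move: uc00 => /eqP; rewrite /u mulf_eq0 invr_eq0 (gt_eqF H0) orbF.
    by rewrite expf_eq0.
  move=> y uy; rewrite leNgt; apply/negP => /ltW Zy.
  by have := cmin y; rewrite inE => /(_ Zy); lra.
exists [set y | u y < b / 2].
  have b20 : u x < b / 2.
    rewrite /u /h subrr modulus0 expr0n mul0r; lra.
  apply: open_nbhs_nbhs; split => //.
  apply: (@open_comp _ _ _ [set r | r < b / 2]) => [y _|]; first exact: uc.
  exact: open_lt.
move=> W g d d' Ag ed dd Wg.
have [g' Ag' g'P] := glue_approximations fc Au u01 b01 dd Ag0 Ag
  (fun y uy => le_trans (bP y uy) ed) Wg.
by exists g' => // y [Wy|/ltW uy]; apply: g'P; [left|right].
Qed.

End Density.
End Subalgebra.

(** * Polynomials on compact subsets of C^n *)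

Section PolynomialFunctions.
Variables (R : realType) (n : nat).
Local Notation C := R[i].
Implicit Types K : set 'rV[C]_n.

Lemma modulus_sum (I : finType) (F : I -> C) :
  modulus (\sum_i F i) <= \sum_i modulus (F i).
Proof.
apply: (big_ind2 (fun z (a : R) => modulus z <= a)) => [|z a w b za wb|//].
  by rewrite modulus0.
exact: le_trans (modulusD _ _) (lerD za wb).
Qed.

Lemma continuous_sum (F : numFieldType) (V : normedModType F) (I : finType)
    (T : topologicalType) (f : I -> T -> V) :
  (forall i, continuous (f i)) -> continuous (fun x => \sum_i f i x).
Proof.
move=> fc x; apply: cvg_big => [|i _]; first exact: add_continuous.
exact: fc.
Qed.

Lemma continuous_meval (T : topologicalType) (v : T -> 'I_n -> C)
    (f : mpoly.mpoly n C) :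
  (forall i, continuous (v^~ i)) -> continuous (fun x => mpoly.meval (v x) f).
Proof.
move=> vc; elim/mpoly.mpolyind: f => [|c m f _ _ IH].
  under eq_fun do rewrite mpoly.meval0.
  exact: cst_continuous.
under eq_fun do rewrite mpoly.mevalD mpoly.mevalZ mpoly.mevalX.
move=> z; apply: cvgD; last exact: IH.
apply: cvgM; first exact: cvg_cst.
apply: cvg_big => [|i _]; first exact: mul_continuous.
elim: (mpoly.fun_of_multinom m i) => [|k IHk]; first exact: cvg_cst.
under eq_fun do rewrite exprS.
rewrite exprS; exact: (cvgM (vc i z) IHk).
Qed.

Lemma continuous_poly_fun (f : mpoly.mpoly n C) : continuous (poly_fun f).
Proof. by apply: continuous_meval => i; exact: coord_continuous. Qed.

(** The density results concern a whole compact space, so [K] becomes one: a filter on the subtype,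
    pushed forward to [T], clusters at a point of [K]. *)
Lemma compact_set_type (T : topologicalType) (K : set T) :
  compact K -> compact [set: K].
Proof.
move=> Kco F FF _.
have FK : F (set_val @^-1` K) by apply: filterE => x; exact: set_valP.
have [y [Ky Fy]] := Kco (set_val @ F) (fmap_proper_filter _ FF) FK.
exists (SigSub (mem_set Ky)); split => // U V FU [W [[W' W'o <-] /= W'y WV]].
have [|z [[x Ux <-] Wz]] := Fy (set_val @` U) W' _
  (open_nbhs_nbhs (conj W'o W'y)).
  rewrite /fmap /=; by apply: filterS FU => x Ux; exists x.
by exists x; split => //; apply: WV.
Qed.

Lemma continuous_set_val (T U : topologicalType) (K : set T) (f : T -> U) :
  continuous f -> continuous (fun x : K => f (set_val x)).
Proof.
move=> fc x; apply: continuous_comp; last exact: fc.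
exact: initial_continuous.
Qed.

Lemma poly_restrictions_subalgebra K : subalgebra (poly_restrictions K).
Proof.
split.
- by exists 1; apply/funext => x; rewrite /poly_fun /= mpoly.meval1.
- move=> c _ _ [f ->] [g ->]; exists (c *: f + g); apply/funext => x.
  by rewrite /poly_fun /= mpoly.mevalD mpoly.mevalZ.
- move=> _ _ [f ->] [g ->]; exists (f * g); apply/funext => x.
  by rewrite /poly_fun /= mpoly.mevalM.
Qed.

Lemma poly_restrictions_continuous K :
  poly_restrictions K `<=` continuous_functions K.
Proof.
by move=> _ [f ->]; apply: continuous_set_val; exact: continuous_poly_fun.
Qed.

Lemma poly_restrictions_coord K i :
  poly_restrictions K (fun x => set_val x 0 i).
Proof.
exists (mpoly.mpolyX C (mpoly.mnm1 i)); apply/funext => x.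
by rewrite /poly_fun /= mpoly.mevalXU.
Qed.

Lemma continuous_functions_closed_subalgebra K :
  closed_subalgebra (continuous_functions K).
Proof.
split.
- exact: subset_refl.
- exact: cst_continuous.
- move=> c f g fc gc x.
  exact: (cvgD (cvgM (cvg_cst c) (fc x)) (gc x)).
- by move=> f g fc gc x; exact: (cvgM (fc x) (gc x)).
- rewrite /closed closureEcvg => f [G GG [Gf cG]].
  by apply: (uniform_limit_continuous GG _ Gf); exact: cG.
Qed.

(** The epsilon form of density, from which both conclusions of the theorem follow for compact
    [K]. *)
Definition polynomials_dense K := forall f : K -> C, continuous f ->
  forall e : R, 0 < e ->
  exists2 g, poly_restrictions K g & forall x, modulus (f x - g x) <= e.

(** A closed subalgebra containing the polynomials contains their uniform limits, and the continuous
    functions form one such subalgebra. *)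
Lemma uniform_poly_algebra_dense K :
  polynomials_dense K -> uniform_poly_algebra K = continuous_functions K.
Proof.
move=> dense; apply/seteqP; split.
  apply: smallest_sub; first exact: continuous_functions_closed_subalgebra.
  exact: poly_restrictions_continuous.
move=> f fc A [[_ _ _ _ Aclosed] polyA].
apply: Aclosed => B /uniform_nbhs[E [+ EB]].
(* The radius of a ball lies in [R[i]]; being positive, it reduces to the real number [e]. *)
rewrite -entourage_from_ballE => -[[e e'] /=].
rewrite ltcE /= => /andP[/eqP-> e0] eE.
have [g polyg fg] := dense f fc (e / 2) (divr_gt0 e0 (ltr0n _ 2)).
exists g; split; first exact: polyA.
apply: EB => x _; apply: eE; rewrite /= -ball_normE /= normr_modulus.
rewrite ltcE /= eqxx /=; apply: le_lt_trans (fg x) _; lra.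
Qed.

Lemma polynomially_convex_dense K :
  compact K -> polynomials_dense K -> polynomially_convex K.
Proof.
move=> /compact_set_type Kco dense; apply/seteqP; split; last first.
  (* [sup] is known to dominate a set only if the set is bounded above, which compactness
     provides. *)
  move=> z Kz f; apply: ub_le_sup; last by exists z.
  have fc : continuous (fun x : K => modulus (poly_fun f (set_val x))).
    by apply/continuous_modulus/continuous_set_val; exact: continuous_poly_fun.
  have [M _ fM] := compact_has_bound Kco fc.
  by exists M => _ [x Kx <-]; have := fM (SigSub (mem_set Kx)).
move=> z hz; apply: contrapT => Kz.
pose D (y : K) := \sum_i (set_val y 0 i - z 0 i) * (set_val y 0 i - z 0 i)^*%C.
have D0 y : D y != 0.
  apply/eqP => Dy0; apply: Kz; suff -> : z = set_val y by exact: set_valP.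
  have : \sum_i modulus (set_val y 0 i - z 0 i) ^+ 2 = 0.
    apply: complexI; rewrite rmorph_sum -[RHS]Dy0.
    by apply: eq_bigr => i _; rewrite mulr_conjc.
  move/psumr_eq0P => yz; apply/rowP => i; apply/eqP; rewrite eq_sym -subr_eq0.
  apply/eqP/modulus_eq0/eqP; rewrite -sqrf_eq0; apply/eqP/yz => // j _.
  exact: sqr_ge0.
have cc i : continuous (fun y : K => set_val y 0 i - z 0 i).
  have xc := poly_restrictions_continuous (poly_restrictions_coord K i).
  by move=> y; exact: (cvgB (xc y) (cvg_cst _)).
have gc i : continuous (fun y : K => (set_val y 0 i - z 0 i)^*%C / D y).
  have jc j : continuous (fun y : K => (set_val y 0 j - z 0 j)^*%C).
    exact: continuous_conjc.
  have Dc : continuous D.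
    by apply: continuous_sum => j y; exact: (cvgM (cc j y) (jc j y)).
  by move=> y; exact: (cvgM (jc i y) (cvgV (D0 y) (Dc y))).
have [M M0 yM] : exists2 M : R, 0 <= M &
    forall y : K, \sum_i modulus (set_val y 0 i - z 0 i) <= M.
  apply: compact_has_bound => //.
  by apply: continuous_sum => i; exact: continuous_modulus.
(* With each quotient approximated within [d], the total error on [K] is at most M d <= 1/2; adding
   1 to [M] avoids dividing by 0. *)
pose d := (2 * (M + 1))^-1.
have d0 : 0 < d by rewrite invr_gt0; lra.
have Md : M * d <= 2^-1.
  rewrite /d invfM mulrCA ler_piMr //. 
  by rewrite ler_pdivrMr; lra.
have /choice[G GP] : forall i, exists G : mpoly.mpoly n C, forall y : K,
    modulus ((set_val y 0 i - z 0 i)^*%C / D y - poly_fun G (set_val y)) <= d.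
  by move=> i; have [_ [G ->] GP] := dense _ (gc i) d d0; exists G.
pose F := 1 - \sum_i
  (mpoly.mpolyX C (mpoly.mnm1 i) - mpoly.mpolyC n (z 0 i)) * G i.
have Fv y : poly_fun F y = 1 - \sum_i (y 0 i - z 0 i) * poly_fun (G i) y.
  rewrite /poly_fun /F mpoly.mevalB mpoly.meval1.
  rewrite (raddf_sum (mpoly.meval (y 0))); congr (1 - _).
  by apply: eq_bigr => i _ /=; rewrite mpoly.mevalM mpoly.mevalB mpoly.mevalXU
    mpoly.mevalC.
have Fz : poly_fun F z = 1.
  by rewrite Fv big1 ?subr0 // => i _; rewrite subrr mul0r.
have FK y : K y -> modulus (poly_fun F y) <= 2^-1.
  move=> Ky; pose x : K := SigSub (mem_set Ky).
  (* Writing the 1 in [F] as D / D leaves only the approximation errors, weighted by the coordinate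
     differences. *)
  have -> : poly_fun F y = \sum_i (y 0 i - z 0 i) *
      ((y 0 i - z 0 i)^*%C / D x - poly_fun (G i) y).
    rewrite Fv -(divff (D0 x)) {1}/D mulr_suml -sumrB.
    by apply: eq_bigr => i _; rewrite mulrBr mulrA.
  apply: le_trans Md; apply: le_trans (modulus_sum _) _.
  apply: le_trans (ler_wpM2r (ltW d0) (yM x)); rewrite mulr_suml.
  by apply: ler_sum => i _; rewrite modulusM ler_wpM2l ?modulus_ge0 // (GP i x).
have := hz F; rewrite Fz modulus1.
apply/negP; rewrite -ltNge; have [K0|/set0P K0] := eqVneq K set0.
  (* On the empty set [sup] defaults to 0, below the value 1 of [F] at [z]. *)
  by rewrite K0 image_set0 sup0.
apply: le_lt_trans (_ : 2^-1 < 1); last by lra.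
apply: ge_sup; first by case: K0 => y Ky; exists (modulus (poly_fun F y)), y.
by move=> _ [y Ky <-]; exact: FK.
Qed.

End PolynomialFunctions.

(** * The curve *)

Lemma finite_horner_fiber (R : realType) (p : {poly R[i]}) (c : R[i]) :
  (1 < size p)%N -> finite_set [set a | p.[a] = c].
Proof.
move=> sp; have pc0 : p - c%:P != 0.
  apply: contraTneq sp => /eqP; rewrite subr_eq0 => /eqP ->.
  by rewrite -leqNgt size_polyC leq_b1.
have [rs rsE] := closed_field_poly_normal (p - c%:P).
apply: sub_finite_set (finite_seq rs) => a /= pa.
rewrite -root_prod_XsubC -(rootZ _ _ (_ : lead_coef (p - c%:P) != 0)).
  by rewrite -rsE /root !hornerE pa subrr.
by rewrite lead_coef_eq0.
Qed.

(** The equation of the curve is used twice: it makes the conjugate of p(z) a polynomial in w, and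
    it confines w to finitely many values on a fibre of p(z). *)
Lemma conj_curve_polynomials_dense (R : realType) (p q : {poly R[i]})
    (K : set 'rV[R[i]]_2) :
  (1 < size p)%N -> (1 < size q)%N -> compact K -> K `<=` conj_curve p q ->
  polynomials_dense K.
Proof.
move=> sp sq Kco Kpq f fc e e0.
have Aalg := poly_restrictions_subalgebra K.
pose phi (x : K) := p.[set_val x 0 0].
have phiE (x : K) : q.[set_val x 0 1] = (phi x)^*%C by exact/Kpq/set_valP.
have Aphi : poly_restrictions K phi.
  exact: (subalgebra_horner Aalg p (poly_restrictions_coord K 0)).
have Aphic : poly_restrictions K (fun x => (phi x)^*%C).
  under eq_fun do rewrite -phiE.
  exact: (subalgebra_horner Aalg q (poly_restrictions_coord K 1)).
apply: (dense_of_fiberwise (compact_set_type Kco) Aalg _ Aphi Aphic fc _ e0).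
  exact: poly_restrictions_continuous.
(* Passing to pairs embeds the fibre in a product of two finite root sets, and distinct points of
   [K] differ in a coordinate. *)
move=> x; pose coords (y : K) := (set_val y 0 0, set_val y 0 1).
have coords_inj : injective coords.
  move=> y z [yz0 yz1]; apply: val_inj; apply/rowP => i.
  have [j ->|->] := unliftP 0 i; last exact: yz0.
  by rewrite (ord1 j) (_ : lift 0 0 = 1) //; exact: val_inj.
have fin : finite_set [set y | phi y = phi x].
  have fin2 := finite_setX (finite_horner_fiber (phi x) sp)
    (finite_horner_fiber (phi x)^*%C sq).
  apply: sub_finite_set (finite_preimage (in2W coords_inj) fin2) => y /= yx.
  by split => //=; rewrite phiE yx.
have [s sE] := (finite_seqP _).1 fin.
have [|g Ag gs] := subalgebra_interpolation s f Aalg.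
  move=> y z yz; have : coords y != coords z by rewrite (inj_eq coords_inj).
  rewrite /coords xpair_eqE negb_and => /orP[] ?.
    exists (fun x : K => set_val x 0 0) => //.
    exact: poly_restrictions_coord.
  by exists (fun x : K => set_val x 0 1) => //; exact: poly_restrictions_coord.
exists g => // y yx; apply: gs.
by have : [set y | phi y = phi x] y by []; rewrite sE.
Qed.

Theorem theorem1p5 (R : realType) (p q : {poly R[i]})
    (p_nonconst : (1 < size p)%N) (q_nonconst : (1 < size q)%N)
    (K : set 'rV[R[i]]_2) (K_compact : compact K)
    (K_sub : K `<=` conj_curve p q) :
  polynomially_convex K /\ uniform_poly_algebra K = continuous_functions K.
Proof.
have dense := conj_curve_polynomials_dense p_nonconst q_nonconst K_compact
  K_sub.
split; first exact: polynomially_convex_dense.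
exact: uniform_poly_algebra_dense.
Qed.
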